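(* (In ZFC set theory.) For a graph $G$ the following are equivalent: (a) $G$ is a generalized Cayley graph of a left-cancellative magma; (b) $G$ is a generalized Cayley graph of a left-cancellative magma with a left identity; (c) $G$ is simple, deterministic and source-complete.
   Context: A graph is a non-empty set $G\subseteq V\times A\times V$ of labeled edges $s\xrightarrow{a}_G t$; $V_G$ is the set of vertices occurring in edges, $A_G$ the set of labels. A graph is a generalized Cayley graph of a magma $(M,\cdot)$ if it equals $\mathcal{C}\langle M,Q\rangle=\{(p,\langle q\rangle,p\cdot q): p\in M,\ q\in Q\}$ for some subset $Q\subseteq M$ and injective map $\langle\,\rangle:Q\to A$. A magma is left-cancellative if $r\cdot p=r\cdot q\Rightarrow p=q$; $e$ is a left identity if $e\cdot p=p$ for all $p$. $G$ is simple if no two edges share source and target; deterministic if $r\xrightarrow{a}s$, $r\xrightarrow{a}t$ imply $s=t$; source-complete if for every $s\in V_G$ and $a\in A_G$ there is $t$ with $s\xrightarrow{a}_G t$. *)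

(* Defs.v *)
From mathcomp Require Import all_boot.
From mathcomp Require Import boolp classical_sets.

Set Implicit Arguments.
Unset Strict Implicit.
Unset Printing Implicit Defensive.

Local Open Scope classical_set_scope.

(* [(s, a, t) : V * A * V] is the edge from s to t labeled by a. *)
Record graph (V A : Type) := Graph {
  edges : set (V * A * V);
  edges_nonempty : edges !=set0
}.

Definition vertices (V A : Type) (G : graph V A) : set V :=
  [set v | exists (a : A) (w : V), edges G (v, a, w) \/ edges G (w, a, v)].

Definition labels (V A : Type) (G : graph V A) : set A :=
  [set a | exists s t : V, edges G (s, a, t)].

Definition simple (V A : Type) (G : graph V A) : Prop :=
  forall (s t : V) (a b : A), edges G (s, a, t) -> edges G (s, b, t) -> a = b.

Definition deterministic (V A : Type) (G : graph V A) : Prop :=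
  forall (r : V) (a : A) (s t : V), edges G (r, a, s) -> edges G (r, a, t) -> s = t.

Definition source_complete (V A : Type) (G : graph V A) : Prop :=
  forall (s : V) (a : A), vertices G s -> labels G a ->
    exists t : V, edges G (s, a, t).

Definition left_cancellative (M : Type) (op : M -> M -> M) : Prop :=
  forall r p q : M, op r p = op r q -> p = q.

(* The carrier of the magma is a set M of elements of V, so that the Cayley
   graph can be compared with a graph by equality, not up to isomorphism: the
   vertices of C<M,Q> are the elements of M themselves. *)
Definition cayley (V A : Type) (M : set V) (op : M -> M -> M)
    (Q : set M) (lab : Q -> A) : set (V * A * V) :=
  [set (\val p, lab q, \val (op p (\val q))) | p in [set: M] & q in [set: Q]].

Definition generalized_cayley_of (V A : Type) (G : graph V A)
    (M : set V) (op : M -> M -> M) : Prop :=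
  exists (Q : set M) (lab : Q -> A),
    injective lab /\ edges G = cayley op lab.

(* Main.v *)
(* To build the magma in (b), take as carrier the vertex set of G, and look for
   a left identity e: then Q must be the set of out-neighbours of e, the
   generator q being labeled like the edge from e to q.  Left translation by a
   vertex p is forced on Q, where it is an injection onto the out-neighbours of
   p, and it extends to an injection of the whole vertex set as soon as the
   non-out-neighbours of e embed into the non-out-neighbours of p.  Cardinals
   being well-ordered, some e achieves this for every p at once. *)
Require Import Defs.
From mathcomp Require Import all_boot.
From mathcomp Require Import boolp classical_sets.

Local Open Scope classical_set_scope.

(* Take a maximal set S of choice functions on which every evaluation is
   injective; if no evaluation were onto, S could be enlarged by a choice
   function avoiding all its values. *)
Lemma exists_least_cardinal (I T : Type) (B : I -> set T) (i0 : I) :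
  exists i, forall j, exists h : T -> T,
    (forall x, B i x -> B j (h x)) /\
    (forall x y, B i x -> B i y -> h x = h y -> x = y).
Proof.
pose P : set (set (I -> T)) := fun S =>
  (forall f, S f -> forall i, B i (f i)) /\
  (forall f g i, S f -> S g -> f i = g i -> f = g).
have [F FP Ftot|S [[SB Sinj] Smax]] := @Zorn_bigcup _ P.
  split=> [f [X FX Xf]|f g i [X FX Xf] [Y FY Yg]]; first exact: (FP X FX).1.
  case: (Ftot X Y FX FY) => XY; [apply: (FP Y FY).2|apply: (FP X FX).2];
  by [|apply: XY].
have [i Si] : exists i, forall x, B i x -> exists2 f, S f & f i = x.
  apply: contrapT => /forallNP noti.
  have /choice[g gP] i : exists x, B i x /\ ~ exists2 f, S f & f i = x.
    by have /existsNP[x /not_implyP ?] := noti i; exists x.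
  have Sg : ~ S g by move=> Sg; have [_] := gP i0; apply; exists g.
  apply: (Smax (S `|` [set g])).
    split=> [f Sf|sub]; first by left.
    by apply: Sg; apply: sub; right.
  split=> [f [/SB //|-> i]|f f' i [Sf|->] [Sf'|->]] //.
  - by have [] := gP i.
  - exact: Sinj.
  - by move=> fg; have [_ []] := gP i; exists f.
  - by move=> fg; have [_ []] := gP i; exists f'.
exists i => j.
(* Evaluation at [i] is a bijection from [S] onto [B i]; [c] inverts it, with junk values outside
   [B i]. Following [c] by evaluation at [j] gives the injection. *)
have /choice[c cP] x : exists f : I -> T, B i x -> S f /\ f i = x.
  have [/Si[f Sf fx]|nBx] := pselect (B i x); first by exists f.
  by exists (fun=> x).
exists (fun x => c x j); split=> [x /cP[/SB + _]|x y /cP[Sx xE] /cP[Sy yE] cxy].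
  exact.
by rewrite -xE -yE (Sinj _ _ j Sx Sy cxy).
Qed.

(** Simplicity comes from left cancellation, determinism from injectivity of the labeling, and
    source-completeness from [op] being total on [M], which contains every vertex. *)
Lemma generalized_cayley_properties {V A : Type} {G : graph V A} {M : set V}
    {op : M -> M -> M} :
  left_cancellative op -> generalized_cayley_of G op ->
  [/\ simple G, deterministic G & source_complete G].
Proof.
move=> opI [Q [lab [labI GE]]].
split=> [s t a b|r a s t|s a]; rewrite ?/vertices ?/labels /= GE.
- move=> [p _ [q _ [ps qa pqt]]] [p' _ [q' _ [ps' qb pqt']]].
  have pp' : p' = p := val_inj (etrans ps' (esym ps)).
  rewrite -qa -qb; congr lab; apply: val_inj; apply: (opI p).
  by rewrite pp' in pqt'; exact: val_inj (etrans pqt (esym pqt')).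
- move=> [p _ [q _ [pr qa <-]]] [p' _ [q' _ [pr' qa' <-]]].
  have -> : p' = p := val_inj (etrans pr' (esym pr)).
  by have -> : q' = q by apply: labI; rewrite qa'.
- move=> sG [_ [_ [_ _ [q _ [_ <- _]]]]].
  have [p <-] : exists p : M, \val p = s.
    case: sG => b [w [|]] [p _ [q' _]] [pE _ qE]; first by exists p.
    by exists (op p (\val q')).
  by exists (\val (op p (\val q))), p => //; exists q.
Qed.

Lemma generalized_cayley_left_id {V A : Type} {G : graph V A} :
  simple G -> deterministic G -> source_complete G ->
  exists (M : set V) (op : M -> M -> M),
    [/\ left_cancellative op, exists e : M, left_id e op
      & generalized_cayley_of G op].
Proof.
move=> simG detG compG; pose M := vertices G.
have srcM s a t : edges G (s, a, t) -> exists p : M, \val p = s.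
  move=> E; have sM : s \in M by apply/mem_set; exists a, t; left.
  by exists (exist _ s sM).
have tgtM s a t : edges G (s, a, t) -> exists p : M, \val p = t.
  move=> E; have tM : t \in M by apply/mem_set; exists a, s; right.
  by exists (exist _ t tM).
have out (p : M) a : labels G a -> exists t : M, edges G (\val p, a, \val t).
  move=> aG; have [t E] := compG (\val p) a (set_mem (valP p)) aG.
  by have [t' tE] := tgtM _ _ _ E; exists t'; rewrite tE.
pose adj (p t : M) := exists a, edges G (\val p, a, \val t).
have [p0 _] : exists p : M, True.
  by have [[[s a] t] /srcM[p _]] := edges_nonempty G; exists p.
have [e emin] := @exists_least_cardinal M M (fun p => [set t | ~ adj p t]) p0.
have transl (p : M) : exists f : M -> M, [/\ injective f,
    forall q a, edges G (\val e, a, \val q) -> edges G (\val p, a, \val (f q))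
    & p = e -> f =1 id].
  (* For [p = e] the injection [h] might move the non-out-neighbours of [e], so the identity is
     imposed; this makes [e] a left identity. *)
  have [->|pe] := pselect (p = e); first by exists id; split.
  have [h [hB hI]] := emin p.
  have /choice[f fP] q : exists t : M,
      (exists2 a, edges G (\val e, a, \val q) & edges G (\val p, a, \val t)) \/
      ~ adj e q /\ t = h q.
    have [[a E]|eq] := pselect (adj e q); last by exists (h q); right.
    have [|t E'] := out p a; first by exists (\val e), (\val q).
    by exists t; left; exists a.
  exists f; split=> // [q q' fqq'|q a E].
    (* Two out-neighbours of [e] with the same image carry the same label by simplicity at [p], so
       they agree by determinism at [e]. In the mixed cases the common image would both be and not
       be an out-neighbour of [p]. *)
    have [[a E Ef]|[nq fq]] := fP q; have [[b E' Ef']|[nq' fq']] := fP q'.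
    - rewrite -fqq' in Ef'; rewrite -(simG _ _ _ _ Ef Ef') in E'.
      exact: val_inj (detG _ _ _ _ E E').
    - by case: (hB q' nq'); exists a; rewrite -fq' -fqq'.
    - by case: (hB q nq); exists b; rewrite -fq fqq'.
    - by apply: hI => //; rewrite -fq -fq'.
  have [[b E' Ef]|[nq _]] := fP q; last by case: nq; exists a.
  by rewrite (simG _ _ _ _ E E').
have [op opP] := choice transl.
pose Q : set M := adj e.
have [lab labP] := choice (fun q : Q => set_mem (valP q) : adj e (\val q)).
exists M, op; split.
- by move=> p q q'; have [opI _ _] := opP p; apply: opI.
- by exists e => q; have [_ _ ->] := opP e.
exists Q, lab; split=> [q q' labE|].
  apply/val_inj/val_inj; apply: (detG _ _ _ _ (labP q)).
  by rewrite labE; exact: labP.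
apply/seteqP; split=> [[[s a] t] E|_ [p _ [q _ <-]]]; last first.
  by have [_ + _] := opP p; apply; exact: labP.
(* Source-completeness at [e] supplies the generator [q] labeled [a]; determinism at [s] then
   identifies [t] with [op p q]. *)
have [p ps] := srcM _ _ _ E.
have [|q Eq] := out e a; first by exists s, t.
have qQ : q \in Q by apply/mem_set; exists a.
exists p => //; exists (exist _ q qQ) => //.
have la : lab (exist _ q qQ) = a := simG _ _ _ _ (labP (exist _ q qQ)) Eq.
rewrite la ps; congr (_, _, _).
by apply: (detG s a) => //; rewrite -ps; have [_ + _] := opP p; apply.
Qed.

Theorem theorem5p5 (V A : Type) (G : graph V A) :
  [<-> exists (M : set V) (op : M -> M -> M),
         left_cancellative op /\ generalized_cayley_of G op;
       exists (M : set V) (op : M -> M -> M),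
         [/\ left_cancellative op, exists e : M, left_id e op
           & generalized_cayley_of G op];
       [/\ simple G, deterministic G & source_complete G]].
Proof.
tfae.
- move=> [M [op [opI Gop]]].
  have [simG detG compG] := generalized_cayley_properties opI Gop.
  exact: generalized_cayley_left_id simG detG compG.
- by move=> [M [op [opI _ Gop]]]; exact: generalized_cayley_properties opI Gop.
- move=> [simG detG compG].
  have [M [op [opI _ Gop]]] := generalized_cayley_left_id simG detG compG.
  by exists M, op.
Qed.
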